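(* For integers $0\le k\le n$ let $$B_k^{(n)}=\sum_{j=0}^{\lfloor k/2\rfloor}\binom{k-j}{j}2^{k-2j}\binom{n-j}{k-2j}.$$ Then $$B_k^{(n)}=2^k\binom{n}{k}\;{}_4F_3\left(\begin{matrix}-\frac{k}{2},\ -\frac{k}{2},\ \frac{1-k}{2},\ \frac{1-k}{2}\\ -k,\ -n,\ n-k+1\end{matrix}\;;\,4\right).$$
   Context: ${}_4F_3\left(\begin{matrix}a_1,a_2,a_3,a_4\\ b_1,b_2,b_3\end{matrix};x\right)=\sum_{j\ge 0}\frac{(a_1)_j(a_2)_j(a_3)_j(a_4)_j}{(b_1)_j(b_2)_j(b_3)_j}\frac{x^j}{j!}$ with Pochhammer symbol $(a)_j=a(a+1)\cdots(a+j-1)$, $(a)_0=1$. The series here is terminating: one of $-k/2$, $(1-k)/2$ is the nonpositive integer $-\lfloor k/2\rfloor$, so the sum is understood as the finite sum over $0\le j\le\lfloor k/2\rfloor$ (for these $j$ no denominator vanishes). *)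

(* Defs.v *)
From mathcomp Require Import all_boot all_order all_algebra.
Set Implicit Arguments.
Unset Strict Implicit.
Unset Printing Implicit Defensive.
Import GRing.Theory Num.Theory.
Local Open Scope ring_scope.

Definition pochhammer (R : numFieldType) (a : R) (j : nat) : R :=
  \prod_(i < j) (a + i%:R).

Definition hyp4F3_term (R : numFieldType)
    (a1 a2 a3 a4 b1 b2 b3 x : R) (j : nat) : R :=
  (pochhammer a1 j * pochhammer a2 j * pochhammer a3 j * pochhammer a4 j)
    / (pochhammer b1 j * pochhammer b2 j * pochhammer b3 j)
  * (x ^+ j / (j`!)%:R).

(* A terminating 4F3 series, as the finite sum over 0 <= j <= N; here N is
   meant to be such that some upper parameter equals - N%:R and no lower
   parameter is one of 0, -1, ..., -(N - 1), so that no denominator vanishes. *)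
Definition hyp4F3 (R : numFieldType) (N : nat)
    (a1 a2 a3 a4 b1 b2 b3 x : R) : R :=
  \sum_(j < N.+1) hyp4F3_term a1 a2 a3 a4 b1 b2 b3 x j.

(* The natural-number subtractions are exact when k <= n, since j <= k./2. *)
Definition B (n k : nat) : nat :=
  (\sum_(j < k./2.+1) 'C(k - j, j) * 2 ^ (k - 2 * j) * 'C(n - j, k - 2 * j))%N.

(* Main.v *)
Require Import Defs.
From mathcomp Require Import all_boot all_order all_algebra.
From mathcomp Require Import zify ring.
Import GRing.Theory Num.Theory.
Local Open Scope ring_scope.

(** The identity holds term by term.  The numerator parameters pair up as
    [-k/2, (1-k)/2] twice, and the duplication formula
    [4^j (a/2)_j ((a+1)/2)_j = (a)_{2j}] turns each pair into
    [(-k)_{2j} / 4^j = k! / ((k-2j)! 4^j)].  The denominators are factorial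
    quotients too: [(-k)_j = (-1)^j k!/(k-j)!], [(-n)_j = (-1)^j n!/(n-j)!] and
    [(n-k+1)_j = (n-k+j)!/(n-k)!].  After multiplication by [2^k 'C(n, k)] the
    [j]-th term becomes
    [2^(k-2j) (k-j)! (n-j)! / (j! (k-2j)!^2 (n-k+j)!)],
    which is the [j]-th summand of [B n k] with its binomials written out in
    factorials. *)

Lemma pochhammerSr (R : numFieldType) (a : R) (j : nat) :
  pochhammer a j.+1 = pochhammer a j * (a + j%:R).
Proof. by rewrite /pochhammer big_ord_recr. Qed.

(** The factors of [(a)_{2j}] alternate between twice those of [(a/2)_j] and
    twice those of [((a+1)/2)_j]. *)
Lemma pochhammer_duplication (R : numFieldType) (a : R) (j : nat) :
  pochhammer (a / 2) j * pochhammer ((1 + a) / 2) j * 4 ^+ j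
  = pochhammer a (2 * j).
Proof.
elim: j => [|j IHj]; first by rewrite /pochhammer muln0 !big_ord0 !mulr1.
have -> : (2 * j.+1 = (2 * j).+2)%N by lia.
rewrite !pochhammerSr -IHj exprS -(natr1 (2 * j)%N) natrM.
by field.
Qed.

Lemma pochhammerN_fact (R : numFieldType) (m j : nat) :
  pochhammer (- (j + m)%:R : R) j * m`!%:R = (-1) ^+ j * (j + m)`!%:R.
Proof.
elim: j m => [|j IHj] m; first by rewrite /pochhammer big_ord0 expr0 add0n.
rewrite pochhammerSr addSnnS exprS -[RHS]mulrA -IHj factS natrM.
by rewrite natrD -(natr1 m); ring.
Qed.

Lemma pochhammerS_fact (R : numFieldType) (m j : nat) :
  pochhammer (m%:R + 1 : R) j * m`!%:R = (m + j)`!%:R.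
Proof.
elim: j => [|j IHj]; first by rewrite /pochhammer big_ord0 mul1r addn0.
rewrite pochhammerSr addnS factS natrM -IHj -natr1 natrD.
by ring.
Qed.

Lemma natr_fact_neq0 (R : numFieldType) (m : nat) : m`!%:R != 0 :> R.
Proof. by rewrite pnatr_eq0 -lt0n fact_gt0. Qed.

Lemma natr_binD (R : numFieldType) (p q : nat) :
  'C(p + q, p)%:R = (p + q)`!%:R / (p`!%:R * q`!%:R) :> R.
Proof.
have E := bin_fact (leq_addr q p); rewrite addKn in E.
by rewrite -E !natrM mulfK // mulf_neq0 ?natr_fact_neq0.
Qed.

(** With [k = 2j + a] and [n = k + b] all the truncated subtractions of the
    [j]-th term become sums of naturals. *)
Lemma B_term_hyp4F3 (R : numFieldType) (j a b : nat) :
  let k := (2 * j + a)%N in let n := (k + b)%N in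
  ('C(j + a, j) * 2 ^ a * 'C(j + a + b, a))%:R =
  2 ^+ k * 'C(n, k)%:R *
  hyp4F3_term (- (k%:R / 2)) (- (k%:R / 2)) ((1 - k%:R) / 2) ((1 - k%:R) / 2)
    (- k%:R) (- n%:R) (b%:R + 1) 4 j :> R.
Proof.
move=> k n.
have f0 m : m`!%:R != 0 :> R by exact: natr_fact_neq0.
have n4 : 4 ^+ j != 0 :> R by rewrite expf_neq0 ?pnatr_eq0.
have Dup : pochhammer (- (k%:R / 2) : R) j * pochhammer ((1 - k%:R) / 2) j
           = k`!%:R / (a`!%:R * 4 ^+ j).
  apply: (mulIf n4); rewrite -mulNr pochhammer_duplication.
  apply: (mulIf (f0 a)); rewrite pochhammerN_fact exprM sqrrN !expr1n mul1r.
  by field; rewrite n4 f0.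
(* The two signs (-1)^j cancel. *)
have Pkn : pochhammer (- k%:R : R) j * pochhammer (- n%:R) j
           = k`!%:R * n`!%:R / ((j + a)`!%:R * (j + a + b)`!%:R).
  have Ek : k = (j + (j + a))%N by rewrite /k; lia.
  have En : n = (j + (j + a + b))%N by rewrite /n /k; lia.
  apply: (canRL (mulfK _)); first by rewrite mulf_neq0.
  rewrite mulrACA Ek En !pochhammerN_fact mulrACA -exprMn.
  by rewrite mulrNN mulr1 expr1n mul1r.
have Pb : pochhammer (b%:R + 1 : R) j = (b + j)`!%:R / b`!%:R.
  by rewrite -pochhammerS_fact mulfK.
have -> : (j + a + b = a + (b + j))%N by lia.
rewrite /hyp4F3_term; set p := pochhammer _ j; set q := pochhammer ((1 - _) / 2) j.
have -> : p * p * q * q = (p * q) ^+ 2 by ring.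
rewrite Dup Pkn Pb.
have -> : (j + a + b = a + (b + j))%N by lia.
rewrite !natrM natrX !natr_binD -/n.
have -> : 2 ^+ k = 4 ^+ j * 2 ^+ a :> R.
  by rewrite exprD exprM -natrX.
by field; rewrite ?f0 ?n4.
Qed.

Theorem mainTheorem5 (R : numFieldType) (n k : nat) (hkn : (k <= n)%N) :
  (B n k)%:R =
  2 ^+ k * 'C(n, k)%:R *
  hyp4F3 k./2
    (- (k%:R / 2)) (- (k%:R / 2)) ((1 - k%:R) / 2) ((1 - k%:R) / 2)
    (- k%:R) (- n%:R) (n%:R - k%:R + 1) 4 :> R.
Proof.
rewrite /B /hyp4F3 natr_sum mulr_sumr; apply: eq_bigr => -[j /= hj] _.
have hjk : (2 * j <= k)%N by lia.
have := B_term_hyp4F3 R j (k - 2 * j) (n - k).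
rewrite /= (subnKC hjk) (subnKC hkn) (natrB _ hkn) => <-.
have -> : (j + (k - 2 * j) = k - j)%N by lia.
by have -> : (k - j + (n - k) = n - j)%N by lia.
Qed.
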